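(* Let $t\in\mathbb{N}$ and let $|\psi_j\rangle\in\{|0\rangle,|1\rangle,|+_{\delta_j}\rangle\}$ with $\delta_j\in[0,2\pi)$ for $j=1,\dots,t$, where $|+_\delta\rangle=(|0\rangle+e^{i\delta}|1\rangle)/\sqrt2$. If at least one qubit is in a state of the form $|+_\delta\rangle$, then $$\chi\left(\bigotimes_{j=1}^t|\psi_j\rangle\right)=\xi\left(\bigotimes_{j=1}^t|\psi_j\rangle\right)=2 ;$$ otherwise $\chi\big(\bigotimes_{j=1}^t|\psi_j\rangle\big)=\xi\big(\bigotimes_{j=1}^t|\psi_j\rangle\big)=1$.
   Context: On $n$ qubits let $c_{2j-1}=Z^{\otimes(j-1)}\otimes X\otimes I^{\otimes(n-j)}$ and $c_{2j}=Z^{\otimes(j-1)}\otimes Y\otimes I^{\otimes(n-j)}$, $j=1,\dots,n$. The set $G_n$ of Gaussian unitaries consists of the $n$-qubit unitaries $V$ for which there is $R\in O(2n)$ with $Vc_jV^\dagger=\sum_kR_{j,k}c_k$ for all $j$. The set of pure Gaussian states is $\mathcal{G}_n=\{V|0\rangle^{\otimes n}:V\in G_n\}$. For an $n$-qubit pure state $|\psi\rangle$, the (Gaussian) rank $\chi(|\psi\rangle)$ is the minimum number $\chi$ of terms in a decomposition $|\psi\rangle=\sum_{j=1}^\chi c_j|\phi_j\rangle$ with $|\phi_j\rangle\in\mathcal{G}_n$, $c_j\in\mathbb{C}$; the (Gaussian) state extent is $\xi(|\psi\rangle)=\min\{\|c\|_1^2:|\psi\rangle=\sum_jc_j|\phi_j\rangle,\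 |\phi_j\rangle\in\mathcal{G}_n,\ c_j\in\mathbb{C}\}$, $\|c\|_1=\sum_j|c_j|$. *)

(* Defs.v *)
From HB Require Import structures.
From mathcomp Require Import all_boot all_order all_algebra.
From mathcomp Require Import complex mxtens.
From mathcomp Require Import all_classical all_reals all_analysis.

Set Implicit Arguments.
Unset Strict Implicit.
Unset Printing Implicit Defensive.

Import Order.TTheory GRing.Theory Num.Theory.

Local Open Scope ring_scope.
Local Open Scope complex_scope.
Local Open Scope classical_set_scope.
Local Open Scope sesquilinear_scope.

(* The number 2 ^ n, written so that [qdim n.+1] is convertible to
   [2 * qdim n] and the tensor products below need no casts. *)
Definition qdim (n : nat) : nat := iter n (muln 2) 1%N.

(* The factor of index [ord0] is the leftmost one. *)
Fixpoint tens_op (R : realType) (n : nat) :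
    ('I_n -> 'M[R[i]]_2) -> 'M[R[i]]_(qdim n) :=
  match n with
  | 0 => fun _ => 1%:M
  | m.+1 => fun A => A ord0 *t tens_op (fun j : 'I_m => A (lift ord0 j))
  end.

Fixpoint tens_ket (R : realType) (n : nat) :
    ('I_n -> 'cV[R[i]]_2) -> 'cV[R[i]]_(qdim n) :=
  match n with
  | 0 => fun _ => 1%:M
  | m.+1 => fun v => v ord0 *t tens_ket (fun j : 'I_m => v (lift ord0 j))
  end.

Definition ket0 (R : realType) : 'cV[R[i]]_2 := delta_mx 0 0.
Definition ket1 (R : realType) : 'cV[R[i]]_2 := delta_mx 1 0.
Arguments ket0 {R}.
Arguments ket1 {R}.

Definition ket_plus (R : realType) (d : R) : 'cV[R[i]]_2 :=
  ((Num.sqrt 2)^-1)%:C *: (ket0 + (cos d +i* sin d) *: ket1).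

Definition pauliX (R : realType) : 'M[R[i]]_2 := delta_mx 0 1 + delta_mx 1 0.
Definition pauliY (R : realType) : 'M[R[i]]_2 :=
  'i%C *: (delta_mx 1 0 - delta_mx 0 1).
Definition pauliZ (R : realType) : 'M[R[i]]_2 := delta_mx 0 0 - delta_mx 1 1.

(* Indices start at 0: [majorana R k] is c_(k+1), so for 0 <= j < n the
   operators with k = 2j and k = 2j+1 carry X, respectively Y, on qubit j. *)
Definition majorana (R : realType) (n : nat) (k : 'I_(2 * n)) :
    'M[R[i]]_(qdim n) :=
  tens_op (fun j : 'I_n =>
    if (j < k./2)%N then pauliZ R
    else if j == k./2 :> nat then (if odd k then pauliY R else pauliX R)
    else 1%:M).
Arguments majorana R {n} k.

Definition gaussian_unitary (R : realType) (n : nat) :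
    set 'M[R[i]]_(qdim n) :=
  [set V | V \is unitarymx /\
    exists Q : 'M[R]_(2 * n),
      Q *m Q^T = 1%:M /\
      forall j, V *m majorana R j *m V ^t* =
                \sum_k (Q j k)%:C *: majorana R k].

Definition gaussian_state (R : realType) (n : nat) :
    set 'cV[R[i]]_(qdim n) :=
  [set V *m tens_ket (fun _ : 'I_n => ket0) | V in @gaussian_unitary R n].

Definition gaussian_decomposition (R : realType) (n : nat)
    (psi : 'cV[R[i]]_(qdim n)) (k : nat) (c : 'I_k -> R[i])
    (phi : 'I_k -> 'cV[R[i]]_(qdim n)) : Prop :=
  (forall j, gaussian_state (phi j)) /\ psi = \sum_j c j *: phi j.

(* The least element of [S], or the junk value [x0] if there is none; so for
   [x != x0], [minimum x0 S = x] says that the minimum is attained. *)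
Definition minimum (d : Order.disp_t) (T : porderType d) (x0 : T) (S : set T) :
    T :=
  xget x0 (S `&` lbound S).

Definition gaussian_rank (R : realType) (n : nat)
    (psi : 'cV[R[i]]_(qdim n)) : nat :=
  minimum 0%N [set k : nat |
    exists (c : 'I_k -> R[i]) (phi : 'I_k -> 'cV[R[i]]_(qdim n)),
      gaussian_decomposition psi c phi].

Definition gaussian_extent (R : realType) (n : nat)
    (psi : 'cV[R[i]]_(qdim n)) : R :=
  minimum 0 [set e : R |
    exists (k : nat) (c : 'I_k -> R[i]) (phi : 'I_k -> 'cV[R[i]]_(qdim n)),
      gaussian_decomposition psi c phi /\
      e = (\sum_j ComplexField.Normc.normc (c j)) ^+ 2].

(* Main.v *)
(* For a real unit vector x the operator c(x) = sum_k x_k c_k squares to 1 and,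
   by the Clifford relations, conjugates c(y) to 2 <x,y> c(x) - c(y); so it is
   a Gaussian unitary, and products of such operators applied to the vacuum are
   Gaussian states.  A product state with at least one |+_d> factor equals
   (g + c(w) g) / sqrt 2 for such a g: adding qubits on the left one by one, a
   factor |0> or |1> only turns c(w) into the Majorana operator Z (x) c(w) up to
   sign, while for a factor |+_d> the operator u = cos d X + sin d Y on the new
   qubit satisfies u^2 = 1 and (1 + u) (1 + W) = (1 + u) (u + W) with
   W = Z (x) c(w), so the new pair is the operator u and the state
   (u + W) / sqrt 2 applied to |0> (x) g.

   Conversely every Gaussian state V |0> is an eigenvector of the parity P,
   the n-fold tensor power of Z: the operator V^* P V anticommutes with every
   c_k, hence preserves the joint kernel of the annihilators, which is spanned
   by the vacuum.  As g and c(w) g have opposite parities,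
   |<g|phi>| + |<c(w) g|phi>| <= 1 for each Gaussian phi, and summing over a
   decomposition gives sqrt 2 <= |c|_1. *)

Require Import Defs.
From mathcomp Require Import all_boot all_order all_algebra.
From mathcomp Require Import complex mxtens.
From mathcomp Require Import all_classical all_reals all_analysis.
From mathcomp Require Import ring.
Import Order.TTheory GRing.Theory Num.Theory.
Local Open Scope ring_scope.

Section GaussianDecompositions.

#[local] Set Implicit Arguments.
#[local] Unset Strict Implicit.
Local Open Scope complex_scope.
Local Open Scope classical_set_scope.
Local Open Scope sesquilinear_scope.

(** * Tensor products *)

Section Tensor.
Variables (C : comPzRingType) (m n p q : nat).
Implicit Types (A : 'M[C]_(m, n)) (B : 'M[C]_(p, q)).

Lemma tensmxDl A1 A2 B : (A1 + A2) *t B = A1 *t B + A2 *t B.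
Proof. by apply/matrixP=> i j; rewrite !mxE mulrDl. Qed.

Lemma tensmxDr A B1 B2 : A *t (B1 + B2) = A *t B1 + A *t B2.
Proof. by apply/matrixP=> i j; rewrite !mxE mulrDr. Qed.

Lemma tensmxZl c A B : (c *: A) *t B = c *: (A *t B).
Proof. by apply/matrixP=> i j; rewrite !mxE mulrA. Qed.

Lemma tensmxZr c A B : A *t (c *: B) = c *: (A *t B).
Proof. by apply/matrixP=> i j; rewrite !mxE mulrCA. Qed.

Lemma tensmxNl A B : (- A) *t B = - (A *t B).
Proof. by apply/matrixP=> i j; rewrite !mxE mulNr. Qed.

Lemma tensmxNr A B : A *t (- B) = - (A *t B).
Proof. by apply/matrixP=> i j; rewrite !mxE mulrN. Qed.

End Tensor.

Lemma tensmx11 (C : comPzRingType) m n :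
  (1%:M : 'M[C]_m) *t (1%:M : 'M[C]_n) = 1%:M.
Proof.
apply/matrixP=> i j.
case: (mxtens_indexP i) => i0 i1; case: (mxtens_indexP j) => j0 j1.
rewrite tensmxE !mxE -natrM mulnb.
by rewrite (can_eq (@mxtens_indexK m n)) xpair_eqE.
Qed.

(* [x *t y] has [1 * 1] columns; [tensv] fixes the type to a column vector,
   so that rewriting sees a product [A *m tensv x y] of the expected shape. *)
Section TensorVector.
Variables (C : comPzRingType) (m n : nat).
Implicit Types (x : 'cV[C]_m) (y : 'cV[C]_n).

Definition tensv x y : 'cV[C]_(m * n) := x *t y.

Lemma mul_tensv (A : 'M[C]_m) (B : 'M[C]_n) x y :
  (A *t B) *m tensv x y = tensv (A *m x) (B *m y).
Proof. exact: (@tensmx_mul C m m n n 1 1 A B x y). Qed.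

Lemma tensvDl x1 x2 y : tensv (x1 + x2) y = tensv x1 y + tensv x2 y.
Proof. exact: (@tensmxDl C m 1 n 1). Qed.

Lemma tensvDr x y1 y2 : tensv x (y1 + y2) = tensv x y1 + tensv x y2.
Proof. exact: (@tensmxDr C m 1 n 1). Qed.

Lemma tensvZl c x y : tensv (c *: x) y = c *: tensv x y.
Proof. exact: (@tensmxZl C m 1 n 1). Qed.

Lemma tensvZr c x y : tensv x (c *: y) = c *: tensv x y.
Proof. exact: (@tensmxZr C m 1 n 1). Qed.

Lemma tensvNl x y : tensv (- x) y = - tensv x y.
Proof. exact: (@tensmxNl C m 1 n 1). Qed.

Lemma tensv0 x : tensv x 0 = 0. Proof. exact: (@tensmx0 C m 1 n 1). Qed.

Lemma tensvE x y i j : tensv x y (mxtens_index (i, j)) 0 = x i 0 * y j 0.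
Proof.
by rewrite !mxE mxtens_indexK /=; congr (x _ _ * y _ _); apply: val_inj.
Qed.

End TensorVector.

(** * Pauli matrices on one qubit *)

Section Qubit.
Variable R : realType.
Local Notation C := R[i].

(** Cancel i in z z^* = |z|^2 at z = i, where |i|^2 = 1 = i (-i). *)
Lemma conjC_i : ('i%C : C)^*%R = - 'i%C.
Proof.
have i2 : 'i%C * 'i%C = -1 :> C by rewrite -expr2 sqr_i.
have n0 : 'i%C != 0 :> C by rewrite eq_complex /= oner_eq0 andbF.
apply: (mulfI n0); rewrite -normCK mulrN i2 opprK -[`|'i%C|]/((Num.sqrt _)%:C).
by rewrite expr0n expr1n add0r sqrtr1 expr1n.
Qed.

Lemma conjC_realC (x : R) : (x%:C)^*%R = x%:C :> C.
Proof. by apply: conj_Creal; rewrite realE !lecE /= eqxx /= le_total. Qed.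

Lemma mulii : 'i%C * 'i%C = -1 :> C.
Proof. by rewrite -expr2 sqr_i. Qed.

Ltac mx2 :=
  apply/matrixP=> [] [[|[|//]] ?] [[|[|//]] ?];
  rewrite !(mxE, big_ord_recl, big_ord0) /=
    ?(mulr0, mul0r, mulr1, mul1r, subr0, sub0r, addr0, add0r, mulrN, mulNr,
      mulii, opprK, oppr0, subrr, addNr, mulr1n, mulr0n).

Lemma pauliXX : pauliX R *m pauliX R = 1%:M.
Proof. by mx2. Qed.

Lemma pauliYY : pauliY R *m pauliY R = 1%:M.
Proof. by mx2. Qed.

Lemma pauliZZ : pauliZ R *m pauliZ R = 1%:M.
Proof. by mx2. Qed.

Lemma pauliXY : pauliX R *m pauliY R = - (pauliY R *m pauliX R).
Proof. by mx2. Qed.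

Lemma pauliXZ : pauliX R *m pauliZ R = - (pauliZ R *m pauliX R).
Proof. by mx2. Qed.

Lemma pauliYZ : pauliY R *m pauliZ R = - (pauliZ R *m pauliY R).
Proof. by mx2. Qed.

Lemma pauliX_herm : (pauliX R)^t* = pauliX R.
Proof. by mx2; rewrite ?rmorph0 ?rmorph1. Qed.

Lemma pauliY_herm : (pauliY R)^t* = pauliY R.
Proof. by mx2; rewrite ?rmorph0 ?rmorphN /= ?conjC_i ?opprK. Qed.

Lemma pauliZ_herm : (pauliZ R)^t* = pauliZ R.
Proof. by mx2; rewrite ?rmorph0 ?rmorphN ?rmorph1. Qed.

Lemma pauliX_ket0 : pauliX R *m ket0 = ket1.
Proof. by mx2. Qed.

Lemma pauliX_ket1 : pauliX R *m ket1 = ket0.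
Proof. by mx2. Qed.

Lemma pauliY_ket1 : pauliY R *m ket1 = - 'i%C *: ket0.
Proof. by mx2. Qed.

Lemma pauliZ_ket0 : pauliZ R *m ket0 = ket0.
Proof. by mx2. Qed.

Lemma pauliZ_ket1 : pauliZ R *m ket1 = - ket1.
Proof. by mx2. Qed.

Lemma pauliY_ket0 : pauliY R *m ket0 = 'i%C *: ket1.
Proof. by mx2. Qed.

End Qubit.

(** * The Clifford algebra of the Majorana operators *)

Section Majorana.
Variable R : realType.
Local Notation C := R[i].

(** Recursion on the leftmost qubit, with a natural-number index so that no ordinal has to be
    recast. An index k >= 2n reaches the empty case and gives 0. *)
Fixpoint majn (n k : nat) : 'M[C]_(qdim n) :=
  match n with
  | 0 => 0
  | m.+1 =>
    match k with
    | 0 => pauliX R *t (1%:M : 'M[C]_(qdim m))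
    | 1 => pauliY R *t (1%:M : 'M[C]_(qdim m))
    | l.+2 => pauliZ R *t majn m l
    end
  end.

Lemma eq_tens_op n (A B : 'I_n -> 'M[C]_2) : A =1 B -> tens_op A = tens_op B.
Proof.
elim: n A B => [|n IH] A B eqAB //=.
by rewrite eqAB; congr (_ *t _); apply: IH => j; apply: eqAB.
Qed.

Lemma tens_op1 n : tens_op (fun _ : 'I_n => 1%:M) = 1%:M :> 'M[C]_(qdim n).
Proof. by elim: n => [|n IH] //=; rewrite IH tensmx11. Qed.

Lemma majoranaE n (k : 'I_(2 * n)) : majorana R k = majn n k.
Proof.
case: k => k /= ltk; rewrite /majorana /=.
elim: n k ltk => [|n IH] k; first by rewrite muln0.
case: k => [|[|k]] /= ltk.
- by rewrite -tens_op1; congr (_ *t _).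
- by rewrite -tens_op1; congr (_ *t _).
- have ltk' : (k < 2 * n)%N by move: ltk; rewrite mulnS.
  rewrite -(IH k ltk'); congr (_ *t _); apply: eq_tens_op => j /=.
  by rewrite negbK.
Qed.

Lemma majn_herm n k : (majn n k)^t* = majn n k.
Proof.
elim: n k => [|n IH] k /=; first by rewrite trmx0 map_mx0.
by case: k => [|[|k]]; rewrite trmx_tens map_mxT ?IH ?trmx1 ?map_mx1
  ?pauliX_herm ?pauliY_herm ?pauliZ_herm.
Qed.

(** Peel off the leftmost qubit. If both operators start with Z, then Z^2 = 1 passes the relation on
    to the rest; otherwise the Pauli relations on that qubit decide, as one of the remaining factors
    is the identity. *)
Lemma majn_anticomm n j k : (j < 2 * n)%N -> (k < 2 * n)%N ->
  majn n j *m majn n k + majn n k *m majn n j = (2 *+ (j == k))%:M.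
Proof.
have anti (A B : 'M[C]_2) m (D : 'M[C]_m) : A *m B = - (B *m A) ->
    (A *m B) *t D + (B *m A) *t D = 0.
  by move=> ->; rewrite tensmxNl addNr.
have diag m : 1%:M + 1%:M = (2 *+ true)%:M :> 'M[C]_m.
  by rewrite mulr1n raddfD.
elim: n j k => [|n IH] j k; first by rewrite muln0.
rewrite mulnS; case: j => [|[|j]] ltj; case: k => [|[|k]] ltk;
  rewrite /= !tensmx_mul ?mul1mx ?mulmx1 ?pauliXX ?pauliYY ?pauliZZ
    ?tensmx11 ?diag ?anti ?mulr0n //.
all: try by rewrite ?(pauliXY, pauliXZ, pauliYZ) ?opprK ?raddf0.
rewrite -tensmxDr IH //.
by rewrite !eqSS -![(2 *+ _)%:M]scalemx1 tensmxZr tensmx11.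
Qed.

(** * Parity and the vacuum *)

Fixpoint parity (n : nat) : 'M[C]_(qdim n) :=
  if n is m.+1 then pauliZ R *t parity m else 1%:M.

Lemma parity_sq n : parity n *m parity n = 1%:M.
Proof.
by elim: n => [|n IH] /=; rewrite ?mulmx1 // tensmx_mul IH pauliZZ tensmx11.
Qed.

Lemma parity_herm n : (parity n)^t* = parity n.
Proof.
elim: n => [|n IH] /=; first by rewrite trmx1 map_mx1.
by rewrite trmx_tens map_mxT IH pauliZ_herm.
Qed.

(** Only on its own qubit does c_k carry a factor anticommuting with Z, namely X or Y; elsewhere it
    carries Z or the identity. *)
Lemma parity_majn n k : parity n *m majn n k = - (majn n k *m parity n).
Proof.
elim: n k => [|n IH] [|[|k]]; rewrite /= ?mulmx0 ?mul0mx ?oppr0 //.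
- by rewrite !tensmx_mul mulmx1 mul1mx -tensmxNl pauliXZ opprK.
- by rewrite !tensmx_mul mulmx1 mul1mx -tensmxNl pauliYZ opprK.
- by rewrite !tensmx_mul IH pauliZZ -tensmxNr.
Qed.

Definition vac n : 'cV[C]_(qdim n) := tens_ket (fun _ => ket0).

Lemma vacS n : vac n.+1 = tensv ket0 (vac n). Proof. by []. Qed.

(** Twice the annihilation operator of mode k: on that qubit X + iY = 2 |0><1|. *)
Definition annih n k := majn n k.*2 + 'i%C *: majn n k.*2.+1.

Lemma annih_vac n k : annih n k *m vac n = 0.
Proof.
elim: n k => [|n IH] [|k]; rewrite /annih mulmxDl -scalemxAl
   ?mul0mx ?scaler0 ?addr0 // vacS !mul_tensv.
  rewrite mul1mx pauliX_ket0 pauliY_ket0 tensvZl scalerA mulii scaleN1r.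
  exact: subrr.
by rewrite -tensvZr -tensvDr scalemxAl -mulmxDl IH tensv0.
Qed.

(** Write v = |0> b_0 + |1> b_1 along the leftmost qubit. The first annihilator sends v to 2 |0>
    b_1, so b_1 = 0; as Z fixes |0>, the others then act on b_0 alone, and induction applies. *)
Lemma annih_uniq n (v : 'cV[C]_(qdim n)) :
  (forall k, (k < n)%N -> annih n k *m v = 0) -> exists l, v = l *: vac n.
Proof.
elim: n v => [|n IH] v killed.
  exists (v 0 0); apply/matrixP=> i j.
  by rewrite !mxE (ord1 i) (ord1 j) mulr1.
pose blk (x : 'I_2) : 'cV[C]_(qdim n) := \col_k v (mxtens_index (x, k)) 0.
have vE : v = tensv ket0 (blk 0) + tensv ket1 (blk 1).
  apply/matrixP=> i j; case: (mxtens_indexP i) => i0 i1.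
  rewrite [j]ord1 mxE !tensvE !mxE /=.
  case: i0 => [[|[|//]] p]; rewrite /= ?mul1r ?mul0r ?add0r ?addr0;
  by congr (v (mxtens_index (_, _)) _); apply: val_inj.
have tensvI (x : 'I_2) (y : 'cV[C]_(qdim n)) :
    tensv (delta_mx x 0) y = 0 -> y = 0.
  move=> /matrixP e; apply/matrixP=> i j.
  have := e (mxtens_index (x, i)) 0.
  by rewrite tensvE !mxE !eqxx mul1r [j]ord1.
have b1 : blk 1 = 0.
  have /= := killed 0%N isT.
  rewrite vE /annih mulmxDl -scalemxAl !mulmxDr !mul_tensv !mul1mx.
  rewrite pauliX_ket0 pauliY_ket0 pauliX_ket1 pauliY_ket1 !tensvZl scalerDr.
  rewrite !scalerA mulii mulrN mulii opprK scaleN1r scale1r addrACA subrr add0r.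
  rewrite -mulr2n -scaler_nat => /eqP.
  by rewrite scaler_eq0 pnatr_eq0 /= => /eqP; apply: tensvI.
have [k ltk|l b0] := IH (blk 0).
  have := killed k.+1 ltk.
  rewrite vE b1 tensv0 addr0 /annih mulmxDl -scalemxAl !mul_tensv pauliZ_ket0.
  rewrite -tensvZr -tensvDr scalemxAl -mulmxDl; exact: tensvI.
by exists l; rewrite vE b1 tensv0 addr0 b0 tensvZr.
Qed.

End Majorana.

(** * Gaussian states *)

Section Gaussian.
Variable R : realType.
Local Notation C := R[i].

Lemma qdim_gt0 n : (0 < qdim n)%N.
Proof. by elim: n => //= n IH; rewrite muln_gt0. Qed.

Definition majcomb n (x : 'I_(2 * n) -> R) : 'M[C]_(qdim n) :=
  \sum_k (x k)%:C *: majn R n k.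

(** By [majcomb_sq], asking for square 1 amounts to asking that the coefficient vector be a unit
    vector. *)
Definition unit_majorana n (W : 'M[C]_(qdim n)) :=
  (exists x, W = majcomb x) /\ W *m W = 1%:M.

Lemma majcomb_majn n k : (k < 2 * n)%N -> exists x, majn R n k = majcomb x.
Proof.
move=> ltk; exists (fun j => (j == Ordinal ltk)%:R).
rewrite /majcomb (bigD1 (Ordinal ltk)) //= eqxx scale1r big1 ?addr0 // => j.
by move/negbTE=> ->; rewrite scale0r.
Qed.

Lemma majcombD n (x y : 'I_(2 * n) -> R) :
  majcomb x + majcomb y = majcomb (fun k => x k + y k).
Proof.
by rewrite -big_split; apply: eq_bigr => k _; rewrite rmorphD scalerDl.
Qed.

Lemma majcombZ n a (x : 'I_(2 * n) -> R) :
  a%:C *: majcomb x = majcomb (fun k => a * x k).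
Proof.
by rewrite scaler_sumr; apply: eq_bigr => k _; rewrite rmorphM scalerA.
Qed.

(** The coefficients move up by two places. Adding them term by term along a list of indices avoids
    an explicit reindexing of ordinals. *)
Lemma majcomb_lift n (x : 'I_(2 * n) -> R) :
  exists y, pauliZ R *t majcomb x = majcomb y :> 'M[C]_(qdim n.+1).
Proof.
have ind (s : seq 'I_(2 * n)) : exists y,
    pauliZ R *t (\sum_(k <- s) (x k)%:C *: majn R n k) =
      majcomb y :> 'M[C]_(qdim n.+1).
  elim: s => [|k s [y IH]].
    exists (fun=> 0); rewrite big_nil tensmx0 /majcomb big1 // => k _.
    by rewrite scale0r.
  have [|z zE] := @majcomb_majn n.+1 k.+2; first by rewrite mulnS !ltnS.
  exists (fun l => x k * z l + y l).
  by rewrite big_cons tensmxDr IH tensmxZr -majcombD -majcombZ -zE.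
exact: ind.
Qed.

Lemma majcomb_herm n (x : 'I_(2 * n) -> R) : (majcomb x)^t* = majcomb x.
Proof.
rewrite /majcomb raddf_sum /= map_mx_sum; apply: eq_bigr => k _.
by rewrite linearZ /= map_mxZ /= conjC_realC majn_herm.
Qed.

Lemma majcomb_anticomm n (x : 'I_(2 * n) -> R) (j : 'I_(2 * n)) :
  majcomb x *m majn R n j + majn R n j *m majcomb x = (2 * x j)%:C%:M.
Proof.
rewrite /majcomb mulmx_suml mulmx_sumr -big_split /=.
rewrite (bigD1 j) //= big1 ?addr0 => [|k nkj].
  rewrite -scalemxAl -scalemxAr -scalerDr majn_anticomm //.
  rewrite eqxx mulr1n scale_scalar_mx; congr (_%:M).
  by rewrite mulrC rmorphM /= rmorph_nat.
rewrite -scalemxAl -scalemxAr -scalerDr majn_anticomm //.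
by rewrite val_eqE (negbTE nkj) mulr0n raddf0 scaler0.
Qed.

(** Twice the square is the sum of x_k times the anticommutator of c(x) with c_k, so off-diagonal
    terms never have to be paired. *)
Lemma majcomb_sq n (x : 'I_(2 * n) -> R) :
  majcomb x *m majcomb x = (\sum_k x k ^+ 2)%:C%:M.
Proof.
have two0 : (2 : C) != 0 by rewrite pnatr_eq0.
apply: (scalerI two0); rewrite scaler_nat mulr2n.
have -> : majcomb x *m majcomb x + majcomb x *m majcomb x = \sum_k (x k)%:C *:
    (majcomb x *m majn R n k + majn R n k *m majcomb x).
  under eq_bigr => k _ do rewrite scalerDr scalemxAr scalemxAl.
  by rewrite big_split -mulmx_sumr -mulmx_suml.
under eq_bigr => k _ do rewrite majcomb_anticomm scale_scalar_mx.
rewrite -raddf_sum scale_scalar_mx; congr (_%:M).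
rewrite rmorph_sum mulr_sumr; apply: eq_bigr => k _.
by rewrite rmorphXn /= rmorphM /= rmorph_nat; ring.
Qed.

Lemma unit_majorana_gaussian n (W : 'M[C]_(qdim n)) :
  unit_majorana W -> gaussian_unitary W.
Proof.
move=> [[x ->] sq1]; split; first by apply/unitarymxP; rewrite majcomb_herm.
have x1 : \sum_k x k ^+ 2 = 1.
  (* Compare one diagonal entry of two scalar matrices; it exists because the dimension is
     positive. *)
  move: sq1; rewrite majcomb_sq => /matrixP.
  move=> /(_ (Ordinal (qdim_gt0 n)) (Ordinal (qdim_gt0 n))).
  by rewrite !mxE eqxx !mulr1n => -[].
(* Since c(x) c_j c(x) = 2 x_j c(x) - c_j, the matrix is 2 x x^T - 1, the negative of a reflection
   because x is a unit vector. *)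
exists (\matrix_(j, k) (2 * x j * x k - (j == k)%:R)); split.
  apply/matrixP=> j k; rewrite !mxE.
  under eq_bigr => l _ do rewrite !mxE.
  have -> : \sum_l (2 * x j * x l - (j == l)%:R) * (2 * x k * x l - (k == l)%:R)
      = 4 * x j * x k * (\sum_l x l ^+ 2) - 2 * x j * (\sum_l (k == l)%:R * x l)
        - 2 * x k * (\sum_l (j == l)%:R * x l)
        + \sum_l (j == l)%:R * (k == l)%:R.
    rewrite !mulr_sumr -!sumrB -big_split /=.
    by apply: eq_bigr => l _; ring.
  have sel (y : 'I_(2 * n) -> R) i : \sum_l (i == l)%:R * y l = y i.
    rewrite (bigD1 i) //= eqxx mul1r big1 ?addr0 // => l.
    by rewrite eq_sym => /negbTE ->; rewrite mul0r.
  by rewrite x1 !sel eq_sym; ring.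
move=> j; rewrite majcomb_herm.
under eq_bigr => k _.
  rewrite majoranaE mxE rmorphB rmorphM scalerBl -scalerA.
  over.
rewrite sumrB -scaler_sumr -/(majcomb x) majoranaE.
rewrite (bigD1 j) //= eqxx scale1r big1 ?addr0; last first.
  by move=> k; rewrite eq_sym => /negbTE ->; rewrite scale0r.
have /(canRL (addrK _)) -> := majcomb_anticomm x j.
by rewrite mulmxBl mul_scalar_mx -mulmxA sq1 mulmx1.
Qed.

Lemma gaussian_unitary_mul n (U V : 'M[C]_(qdim n)) :
  gaussian_unitary U -> gaussian_unitary V -> gaussian_unitary (U *m V).
Proof.
move=> [uU [P [PP PU]]] [uV [Q [QQ QV]]].
split; first exact: mul_unitarymx.
(* V turns c_j into row j of Q, and U then acts on each c_k through P: the order of the factors is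
   reversed. *)
exists (Q *m P); split.
  by rewrite trmx_mul mulmxA -(mulmxA Q) PP mulmx1.
move=> j; rewrite trmx_mul map_mxM !mulmxA -(mulmxA U V) -(mulmxA U) QV.
rewrite mulmx_sumr mulmx_suml.
under eq_bigr => k _ do rewrite -scalemxAr -scalemxAl PU scaler_sumr.
rewrite exchange_big; apply: eq_bigr => l _ /=.
rewrite mxE rmorph_sum scaler_suml; apply: eq_bigr => k _.
by rewrite scalerA rmorphM.
Qed.

(** * Norm and parity of Gaussian states *)

Lemma unitary_adjointK n (V : 'M[C]_n) : V \is unitarymx -> V^t* *m V = 1%:M.
Proof. by move/unitarymxP; apply: mulmx1C. Qed.

Lemma tensv_sqnorm m n (x : 'cV[C]_m) (y : 'cV[C]_n) :
  x^t* *m x = 1%:M -> y^t* *m y = 1%:M ->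
  (tensv x y)^t* *m tensv x y = 1%:M.
Proof.
move=> x1 y1; have -> : (tensv x y)^t* = (x^t* *t y^t* : 'M[C]_(1, m * n)).
  by apply/matrixP=> i j; rewrite !mxE rmorphM.
transitivity ((x^t* *m x) *t (y^t* *m y) : 'M[C]_1).
  exact: (@tensmx_mul C 1 m 1 n 1 1).
rewrite x1 y1; exact: (@tensmx11 C 1 1).
Qed.

Lemma vac_sqnorm n : (vac R n)^t* *m vac R n = 1%:M.
Proof.
elim: n => [|n IH]; first by rewrite trmx1 map_mx1 mulmx1.
apply: tensv_sqnorm IH.
apply/matrixP=> i j; rewrite (ord1 i) (ord1 j) !mxE.
rewrite !big_ord_recl big_ord0 !mxE /=.
by rewrite rmorph0 rmorph1 mulr0 mulr1 !addr0.
Qed.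

Lemma gaussian_state_sqnorm n (g : 'cV[C]_(qdim n)) :
  gaussian_state g -> g^t* *m g = 1%:M.
Proof.
move=> [V [uV _] <-]; rewrite -/(vac R n) trmx_mul map_mxM mulmxA.
by rewrite -(mulmxA _ (V^t*)) (unitary_adjointK uV) mulmx1 vac_sqnorm.
Qed.

Lemma gaussian_state_neq0 n (g : 'cV[C]_(qdim n)) : gaussian_state g -> g != 0.
Proof.
move=> /gaussian_state_sqnorm; apply: contra_eq_neq => ->.
by rewrite mulmx0 eq_sym -scalemx1 scaler_eq0 oner_eq0 /= matrix_nonzero1.
Qed.

Lemma gaussian_state_parity n (g : 'cV[C]_(qdim n)) : gaussian_state g ->
  parity R n *m g = g \/ parity R n *m g = - g.
Proof.
move=> [V [uV [Q [QQ QV]]] <-]; rewrite -/(vac R n).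
pose T := V^t* *m parity R n *m V.
have VT : V *m T = parity R n *m V.
  by rewrite !mulmxA (unitarymxP uV) mul1mx.
have anti k : (k < 2 * n)%N -> T *m majn R n k = - (majn R n k *m T).
  move=> ltk; have := QV (Ordinal ltk); rewrite majoranaE /=.
  set S := \sum_k _ => SE.
  (* [S] is V c_k V^*, a combination of Majorana operators, each of which anticommutes with the
     parity. *)
  have PS : parity R n *m S = - (S *m parity R n).
    rewrite mulmx_sumr mulmx_suml -sumrN; apply: eq_bigr => l _.
    by rewrite majoranaE -scalemxAr parity_majn scalerN -scalemxAl.
  have VM : V *m majn R n k = S *m V.
    by rewrite -SE -!mulmxA (unitary_adjointK uV) mulmx1.
  rewrite -[LHS]mulmxA VM mulmxA -(mulmxA _ (parity R n)) PS mulmxN mulNmx.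
  have VS : V^t* *m S = majn R n k *m V^t*.
    by rewrite -SE !mulmxA (unitary_adjointK uV) mul1mx.
  by congr (- _); rewrite !mulmxA VS.
have [k ltk|l Tl] := @annih_uniq R n (T *m vac R n).
  (* Both indices 2k and 2k+1 are in range, so [T] anticommutes with the whole annihilator, which
     then reaches the vacuum. *)
  have le2 : (k.*2.+1 < 2 * n)%N by rewrite mul2n -doubleS leq_double.
  rewrite mulmxA /annih mulmxDl -scalemxAl.
  have /eqP := anti _ le2; rewrite -eqr_oppLR => /eqP <-.
  have /eqP := anti _ (ltnW le2); rewrite -eqr_oppLR => /eqP <-.
  rewrite scalerN -opprD scalemxAr -mulmxDr mulNmx -mulmxA annih_vac.
  by rewrite mulmx0 oppr0.
have PV : parity R n *m (V *m vac R n) = l *: (V *m vac R n).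
  by rewrite mulmxA -VT -mulmxA Tl scalemxAr.
have gV : V *m vac R n != 0 
  by apply: gaussian_state_neq0; exists V => //; split=> //; exists Q.
(* P^2 = 1 leaves only the eigenvalues 1 and -1. *)
have : (l ^+ 2 - 1) *: (V *m vac R n) == 0.
  rewrite scalerBl scale1r expr2 -scalerA -PV scalemxAr -PV.
  by rewrite (mulmxA (parity R n) (parity R n)) parity_sq mul1mx subrr.
rewrite scaler_eq0 (negbTE gV) orbF subr_eq0 sqrf_eq1 PV.
by case/orP=> /eqP ->; rewrite ?scaleN1r ?scale1r; [left|right].
Qed.

(** Kept inductive so that adding a qubit is an induction on the number of factors instead of an
    extension of an arbitrary Gaussian unitary. *)
Inductive majorana_state n : 'cV[C]_(qdim n) -> Prop :=
| majorana_state_vac : majorana_state (vac R n)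
| majorana_state_mul W g : unit_majorana W -> majorana_state g ->
    majorana_state (W *m g).

Lemma gaussian_unitary1 n : gaussian_unitary (1%:M : 'M[C]_(qdim n)).
Proof.
split; first by apply/unitarymxP; rewrite trmx1 map_mx1 mulmx1.
exists 1%:M; split; first by rewrite trmx1 mulmx1.
move=> j; rewrite trmx1 map_mx1 mulmx1 mul1mx.
rewrite (bigD1 j) //= mxE eqxx scale1r big1 ?addr0 // => k.
by rewrite mxE eq_sym => /negbTE ->; rewrite scale0r.
Qed.

Lemma majorana_state_gaussian n (g : 'cV[C]_(qdim n)) :
  majorana_state g -> gaussian_state g.
Proof.
elim=> [|W h uW _ [V gV <-]].
  by exists 1%:M; [exact: gaussian_unitary1 | rewrite mul1mx].
exists (W *m V); last by rewrite mulmxA.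
exact: gaussian_unitary_mul (unit_majorana_gaussian uW) gV.
Qed.

Lemma unit_majorana_lift n (W : 'M[C]_(qdim n)) :
  unit_majorana W -> unit_majorana (pauliZ R *t W : 'M[C]_(qdim n.+1)).
Proof.
move=> [[x ->] sq1]; split; first exact: majcomb_lift.
by rewrite tensmx_mul pauliZZ sq1 tensmx11.
Qed.

Lemma unit_majoranaN n (W : 'M[C]_(qdim n)) :
  unit_majorana W -> unit_majorana (- W).
Proof.
move=> [[x ->] sq1]; split; last by rewrite mulmxN mulNmx opprK.
by exists (fun k => -1 * x k); rewrite -majcombZ rmorphN1 scaleN1r.
Qed.

(** Since Z fixes |0>, the vector |0> (x) W g is Z (x) W applied to |0> (x) g. *)
Lemma majorana_state_lift n (g : 'cV[C]_(qdim n)) :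
  majorana_state g -> majorana_state (tensv ket0 g : 'cV[C]_(qdim n.+1)).
Proof.
elim=> [|W h uW _ IH]; first by rewrite -vacS; left.
rewrite -(pauliZ_ket0 R) -mul_tensv; right=> //.
exact: unit_majorana_lift.
Qed.

(** Writing u for this operator, u |0> = e^{id} |1>, so |+_d> = (1 + u) |0> / sqrt 2. *)
Definition pauliU (d : R) : 'M[C]_2 :=
  (cos d)%:C *: pauliX R + (sin d)%:C *: pauliY R.

Lemma anticommuting_sq n (A B : 'M[C]_n) a b :
  A *m A = 1%:M -> B *m B = 1%:M -> A *m B = - (B *m A) ->
  a ^+ 2 + b ^+ 2 = 1 ->
  (a *: A + b *: B) *m (a *: A + b *: B) = 1%:M.
Proof.
move=> AA BB AB ab1.
rewrite mulmxDl !mulmxDr -!scalemxAl -!scalemxAr AA BB AB.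
rewrite !scalerA scalerN (mulrC b a) addrACA addrA addrK.
by rewrite -scalerDl -!expr2 ab1 scale1r.
Qed.

Lemma pauliUU d : pauliU d *m pauliU d = 1%:M.
Proof.
apply: anticommuting_sq; [exact: pauliXX|exact: pauliYY|exact: pauliXY|].
by rewrite -!rmorphXn -rmorphD /= cos2Dsin2.
Qed.

Lemma pauliU_ket0 d : pauliU d *m ket0 = (cos d +i* sin d) *: ket1.
Proof.
rewrite mulmxDl -2!scalemxAl pauliX_ket0 pauliY_ket0 scalerA -scalerDl.
by rewrite [cos d +i* sin d]complexE mulrC.
Qed.

Lemma pauliUZ d : pauliU d *m pauliZ R = - (pauliZ R *m pauliU d).
Proof.
move: (pauliXZ R) (pauliYZ R); rewrite /pauliU.
move: (pauliX R) (pauliY R) (pauliZ R) => X Y Z XZ YZ.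
by rewrite mulmxDl mulmxDr -!scalemxAl -!scalemxAr XZ YZ !scalerN opprD.
Qed.

Definition first_majorana n d : 'M[C]_(qdim n.+1) :=
  pauliU d *t (1%:M : 'M[C]_(qdim n)).

Lemma first_majorana_unit n d : unit_majorana (first_majorana n d).
Proof.
split; last by rewrite tensmx_mul pauliUU mulmx1 tensmx11.
have [|x xE] := @majcomb_majn n.+1 0; first by rewrite muln_gt0.
have [|y yE] := @majcomb_majn n.+1 1; first by rewrite mulnS.
exists (fun k => cos d * x k + sin d * y k).
by rewrite -majcombD -!majcombZ -xE -yE /first_majorana tensmxDl 2!tensmxZl.
Qed.

Lemma sqrt2VM : (((Num.sqrt 2)^-1)%:C * ((Num.sqrt 2)^-1)%:C) *+ 2 = 1 :> C.
Proof.
rewrite -rmorphM /= -expr2 exprVn sqr_sqrtr ?ler0n // -rmorphMn /= -mulr_natr.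
by rewrite mulVf ?pnatr_eq0.
Qed.

(** Anticommutation cancels the cross terms of the square, so dividing by sqrt 2 restores square
    1. *)
Lemma unit_majorana_halfsum n (U W : 'M[C]_(qdim n)) :
  unit_majorana U -> unit_majorana W -> U *m W = - (W *m U) ->
  unit_majorana (((Num.sqrt 2)^-1)%:C *: (U + W)).
Proof.
move=> [[x ->] U1] [[y ->] W1] UW; split.
  exists (fun k => (Num.sqrt 2)^-1 * (x k + y k)).
  by rewrite majcombD majcombZ.
rewrite scalerDr; apply: anticommuting_sq => //.
by rewrite -mulr2n expr2 sqrt2VM.
Qed.

(** * Product states built from Gaussian states *)

Lemma tens_ketS n (psi : 'I_n.+1 -> 'cV[C]_2) :
  tens_ket psi = tensv (psi ord0) (tens_ket (fun j => psi (lift ord0 j))).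
Proof. by []. Qed.

Lemma basis_ket_majorana_state n (psi : 'I_n -> 'cV[C]_2) :
  (forall j, psi j = ket0 \/ psi j = ket1) -> majorana_state (tens_ket psi).
Proof.
elim: n psi => [|n IH] psi hpsi; first exact: majorana_state_vac.
rewrite tens_ketS.
set tl := tens_ket _; have tlG : majorana_state tl by apply: IH.
have [->|->] := hpsi ord0; first exact: majorana_state_lift.
(* At angle 0 the operator [pauliU] is X, which creates |1> from |0>. *)
have e : tensv ket1 tl = first_majorana n 0 *m tensv ket0 tl.
  by rewrite mul_tensv pauliU_ket0 mul1mx cos0 sin0 complexr0 scale1r.
rewrite e; right; first exact: first_majorana_unit.
exact: majorana_state_lift.
Qed.

Lemma plus_ket_decomp n (psi : 'I_n -> 'cV[C]_2) :
  (forall j, [\/ psi j = ket0, psi j = ket1 | exists d, psi j = ket_plus d]) ->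
  (exists j d, psi j = ket_plus d) ->
  exists (g : 'cV[C]_(qdim n)) (W : 'M[C]_(qdim n)),
    [/\ majorana_state g, unit_majorana W &
        tens_ket psi = ((Num.sqrt 2)^-1)%:C *: (g + W *m g)].
Proof.
elim: n psi => [|n IH] psi hpsi plus; first by case: plus => -[].
rewrite tens_ketS.
set tl := tens_ket _; set s := ((Num.sqrt 2)^-1)%:C.
have [tlplus|tlbasis] := pselect (exists j d, psi (lift ord0 j) = ket_plus d).
  have [g [W [gG uW tlE]]] := IH _ (fun j => hpsi (lift ord0 j)) tlplus.
  have g0G := majorana_state_lift gG; have uZW := unit_majorana_lift uW.
  rewrite /tl tlE -/s; have [->|->|[d ->]] := hpsi ord0.
  - exists (tensv ket0 g), (pauliZ R *t W); split=> //.
    by rewrite mul_tensv pauliZ_ket0 tensvZr tensvDr.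
  (* As Z |1> = - |1>, the new Majorana operator takes a sign. *)
  - exists (first_majorana n 0 *m tensv ket0 g), (- (pauliZ R *t W)).
    split; [by right=> //; exact: first_majorana_unit | exact: unit_majoranaN|].
    rewrite mulNmx !mul_tensv pauliU_ket0 mul1mx cos0 sin0 complexr0 scale1r.
    by rewrite pauliZ_ket1 tensvNl opprK tensvZr tensvDr.
  pose U := first_majorana n d.
  have uU : unit_majorana U := first_majorana_unit n d.
  (* The roles change: the normalised sum of [U] and Z (x) W, which anticommute, builds the state,
     and [U] becomes the Majorana operator. *)
  exists ((s *: (U + pauliZ R *t W)) *m tensv ket0 g), U; split=> //.
    right=> //; apply: unit_majorana_halfsum => //.
    by rewrite !tensmx_mul pauliUZ mul1mx mulmx1 tensmxNl.
  rewrite -scalemxAl -scalemxAr -scalerDr scalerA mulmxDl mulmxDr.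
  (* U^2 = 1 makes the four terms on both sides agree. *)
  rewrite mulmxA (proj2 uU) mul1mx !mul_tensv !mul1mx pauliU_ket0 pauliZ_ket0.
  rewrite /ket_plus -/s tensvZl tensvZr scalerA; congr (_ *: _).
  rewrite tensvDl !tensvDr addrACA [RHS]addrC [RHS]addrACA.
  congr (_ + _).
  by rewrite pauliU_ket0 addrC.
have tlG : majorana_state tl.
  apply: basis_ket_majorana_state => j.
  have [->|->|pl] := hpsi (lift ord0 j); [by left|by right|].
  by case: tlbasis; exists j.
(* No |+_d> occurs in the tail, so the given one is the leftmost factor. *)
have [d ->] : exists d, psi ord0 = ket_plus d.
  have [j [d psij]] := plus; case: (unliftP ord0 j) psij => [k ->|->] pl.
    by case: tlbasis; exists k, d.
  by exists d.
exists (tensv ket0 tl), (first_majorana n d).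
split; [exact: majorana_state_lift | exact: first_majorana_unit|].
by rewrite mul_tensv mul1mx pauliU_ket0 /ket_plus -/s tensvZl tensvDl.
Qed.

End Gaussian.

(** * Lower bounds *)

(** Antisymmetry makes a least element unique, so [xget] has no choice and does not return the
    default. *)
Lemma minimumE (d : Order.disp_t) (T : porderType d) (x0 m : T) (S : set T) :
  S m -> lbound S m -> minimum x0 S = m.
Proof.
move=> Sm lbm; apply: xget_subset1 => // x y [Sx lbx] [Sy lby].
by apply/eqP; rewrite eq_le lbx // lby.
Qed.

Section Bounds.
Variable R : realType.
Local Notation C := R[i].

Definition overlap n (x y : 'cV[C]_n) : C := (x^t* *m y) 0 0.

Lemma overlap_le1 n (x y : 'cV[C]_n) :
  x^t* *m x = 1%:M -> y^t* *m y = 1%:M -> `|overlap x y| <= 1.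
Proof.
(* [dotmx] pairs row vectors, hence the adjoints. *)
move=> x1 y1; have [+ _] := CauchySchwarz (@dotmx C n) (x^t*) (y^t*).
rewrite [X in `|X|]dotmxE [X in _ <= X * _]dotmxE [X in _ <= _ * X]dotmxE.
by rewrite !trmxCK x1 y1 [_%:M _ _]mxE eqxx mulr1 expr_le1.
Qed.

(** P is self-adjoint with P^2 = 1, so <x|y> = <Px|Py> = -<x|y>. *)
Lemma overlap_opposite_parity n (x y : 'cV[C]_(qdim n)) :
  parity R n *m x = x -> parity R n *m y = - y ->
  overlap x y = 0 /\ overlap y x = 0.
Proof.
have two0 : (2 : C) != 0 by rewrite pnatr_eq0.
have anti (u v : 'cV[C]_(qdim n)) :
    (parity R n *m u)^t* *m (parity R n *m v) = - (u^t* *m v) ->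
    overlap u v = 0.
  rewrite trmx_mul map_mxM parity_herm mulmxA -(mulmxA (u^t*)) parity_sq mulmx1.
  move/eqP; rewrite eq_sym -subr_eq0 -opprD oppr_eq0 -mulr2n -scaler_nat.
  by rewrite scaler_eq0 (negbTE two0) /overlap => /eqP ->; rewrite mxE.
move=> Px Py; split; apply: anti; rewrite Px Py ?mulmxN //.
by rewrite raddfN /= map_mxN mulNmx.
Qed.

Lemma majcomb_parity n (x : 'I_(2 * n) -> R) (v : 'cV[C]_(qdim n)) :
  parity R n *m (majcomb x *m v) = - (majcomb x *m (parity R n *m v)).
Proof.
rewrite !mulmxA -mulNmx; congr (_ *m _).
rewrite mulmx_sumr mulmx_suml -sumrN; apply: eq_bigr => l _.
by rewrite -scalemxAr parity_majn scalerN -scalemxAl.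
Qed.

Lemma overlap_decomp n (x psi : 'cV[C]_(qdim n)) k (c : 'I_k -> C) phi :
  gaussian_decomposition psi c phi ->
  overlap x psi = \sum_j c j * overlap x (phi j).
Proof.
move=> [_ ->]; rewrite /overlap mulmx_sumr summxE; apply: eq_bigr => j _.
by rewrite -scalemxAr mxE.
Qed.

(** [W] is odd, so g and W g have opposite parities; phi has a definite parity too and is orthogonal
    to one of them. *)
Lemma gaussian_majorana_overlap n (g : 'cV[C]_(qdim n)) W phi :
  gaussian_state g -> unit_majorana W -> gaussian_state phi ->
  overlap g phi = 0 \/ overlap (W *m g) phi = 0.
Proof.
move=> gG [[x ->] _] phiG; have := majcomb_parity x g.
have [Pg|Pg] := gaussian_state_parity gG; rewrite Pg ?mulmxN ?opprK => PW;
have [Pphi|Pphi] := gaussian_state_parity phiG.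
- by right; have [] := overlap_opposite_parity Pphi PW.
- by left; have [] := overlap_opposite_parity Pg Pphi.
- by left; have [] := overlap_opposite_parity Pphi Pg.
- by right; have [] := overlap_opposite_parity PW Pphi.
Qed.

Lemma gaussian_majorana_ortho n (g : 'cV[C]_(qdim n)) W :
  gaussian_state g -> unit_majorana W ->
  overlap g (W *m g) = 0 /\ overlap (W *m g) g = 0.
Proof.
move=> gG [[x ->] _]; have := majcomb_parity x g.
have [Pg|Pg] := gaussian_state_parity gG; rewrite Pg ?mulmxN ?opprK => PW.
- exact: overlap_opposite_parity Pg PW.
- by have [] := overlap_opposite_parity PW Pg.
Qed.

(** * Rank and extent *)

Lemma sum_normc k (c : 'I_k -> C) :
  (\sum_j ComplexField.Normc.normc (c j))%:C = \sum_j `|c j|.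
Proof. by rewrite rmorph_sum. Qed.

Lemma gaussian_rank_extent1 n (psi : 'cV[C]_(qdim n)) : gaussian_state psi ->
  gaussian_rank psi = 1%N /\ gaussian_extent psi = 1.
Proof.
move=> psiG.
have dec : gaussian_decomposition psi (fun _ : 'I_1 => 1) (fun=> psi).
  by split=> //; rewrite big_ord_recl big_ord0 scale1r addr0.
split; apply: minimumE.
- by exists (fun=> 1), (fun=> psi).
- move=> k [c [phi [_ psiE]]]; rewrite leEnat lt0n; apply: contra_eq_neq psiE.
  move=> k0; subst k; rewrite big_ord0; exact: gaussian_state_neq0.
- exists 1%N, (fun=> 1), (fun=> psi); split=> //.
  by rewrite big_ord_recl big_ord0 addr0 ComplexField.Normc.normc1 expr1n.
move=> _ [k [c [phi [dec' ->]]]].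
have ge0 : 0 <= \sum_j ComplexField.Normc.normc (c j).
  by rewrite -lecR sum_normc sumr_ge0.
rewrite expr_ge1 // -lecR sum_normc.
(* Pair the decomposition with psi itself: 1 = <psi|psi> is at most the sum of |c_j| |<psi|phi_j>|,
   and each overlap is at most 1. *)
have := overlap_decomp psi dec'.
rewrite {1}/overlap gaussian_state_sqnorm // mxE eqxx => /(congr1 Num.norm).
rewrite normr1 rmorph1 => ->; apply: (le_trans (ler_norm_sum _ _ _)).
apply: ler_sum => j _.
rewrite normrM ler_piMr // overlap_le1 ?gaussian_state_sqnorm //.
by case: dec'.
Qed.

Lemma gaussian_rank_extent2 n (g : 'cV[C]_(qdim n)) W :
  gaussian_state g -> unit_majorana W ->
  gaussian_rank (((Num.sqrt 2)^-1)%:C *: (g + W *m g)) = 2%N /\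
  gaussian_extent (((Num.sqrt 2)^-1)%:C *: (g + W *m g)) = 2.
Proof.
move=> gG uW; set s := ((Num.sqrt 2)^-1)%:C; set psi := s *: _.
have gWG : gaussian_state (W *m g).
  have [V VG <-] := gG; exists (W *m V); last by rewrite mulmxA.
  exact: gaussian_unitary_mul (unit_majorana_gaussian uW) VG.
have [ogW oWg] := gaussian_majorana_ortho gG uW.
(* This number is both the sum of the two coefficients of the explicit decomposition and the sum of
   the overlaps of psi with g and W g. *)
have ss2 : s *+ 2 = (Num.sqrt 2)%:C.
  rewrite -rmorphMn /= -mulr_natr -{2}(@sqr_sqrtr _ 2) ?ler0n //.
  by rewrite expr2 mulKf // sqrtr_eq0 -ltNge ltr0n.
have s0 : 0 < s by rewrite ltcR invr_gt0 sqrtr_gt0 ltr0n.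
have og : overlap g psi = s.
  rewrite /overlap -scalemxAr mulmxDr gaussian_state_sqnorm // mxE.
  by rewrite [X in _ * X]mxE -/(overlap g (W *m g)) ogW mxE addr0 mulr1.
have oW : overlap (W *m g) psi = s.
  rewrite /overlap -scalemxAr mulmxDr gaussian_state_sqnorm // mxE.
  by rewrite [X in _ * X]mxE -/(overlap (W *m g) g) oWg mxE add0r mulr1.
have dec : gaussian_decomposition psi (fun _ : 'I_2 => s)
    (fun j => if j == 0 then g else W *m g).
  split=> [j|]; first by case: ifP.
  by rewrite !big_ord_recl big_ord0 /= addr0 -scalerDr.
have lower k (c : 'I_k -> C) phi : gaussian_decomposition psi c phi ->
    Num.sqrt 2 <= \sum_j ComplexField.Normc.normc (c j).
  move=> dec'; rewrite -lecR sum_normc -ss2 mulr2n.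
  (* Replace the two copies of [s] by the overlaps and expand both along the decomposition. *)
  rewrite -{1}(gtr0_norm s0) -[X in _ + X](gtr0_norm s0) -{1}og -oW.
  rewrite !(overlap_decomp _ dec').
  apply: (le_trans (lerD (ler_norm_sum _ _ _) (ler_norm_sum _ _ _))).
  rewrite -big_split /=; apply: ler_sum => j _.
  have phiG := proj1 dec' j.
  rewrite !normrM -mulrDr ler_piMr //.
  have [->|->] := gaussian_majorana_overlap gG uW phiG;
    by rewrite normr0 ?add0r ?addr0 overlap_le1 ?gaussian_state_sqnorm.
have sqrt2_gt0 : 0 < Num.sqrt 2 :> R by rewrite sqrtr_gt0 ltr0n.
split; apply: minimumE.
- by do 2 eexists; exact: dec.
- move=> k [c [phi dec']]; rewrite leEnat.
  have := lower _ _ _ dec'; case: k c phi dec' => [|[|//]] c phi dec'.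
    (* An empty decomposition contradicts the positive lower bound. *)
    by rewrite big_ord0 leNgt sqrt2_gt0.
  have phiG := proj1 dec' 0.
  have o1 x := overlap_decomp x dec'.
  (* A single term is orthogonal to g or to W g, whereas psi has overlap s > 0 with both. *)
  have [z|z] := gaussian_majorana_overlap gG uW phiG.
    by move: (o1 g); rewrite big_ord1 z mulr0 og => /eqP; rewrite gt_eqF.
  by move: (o1 (W *m g)); rewrite big_ord1 z mulr0 oW => /eqP; rewrite gt_eqF.
- do 3 eexists; split; first exact: dec.
  suff -> : \sum_(j < 2) ComplexField.Normc.normc s = Num.sqrt 2.
    by rewrite sqr_sqrtr // ler0n.
  apply: complexI; rewrite sum_normc !big_ord_recl big_ord0 addr0.
  by rewrite (gtr0_norm s0) -mulr2n ss2.
move=> _ [k [c [phi [dec' ->]]]].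
have low := lower _ _ _ dec'.
rewrite -(@sqr_sqrtr _ 2) ?ler0n // ler_pXn2r // nnegrE ?ltW //.
exact: lt_le_trans low.
Qed.

End Bounds.

End GaussianDecompositions.

Theorem lemma15 (R : realType) (t : nat) (delta : 'I_t -> R)
    (psi : 'I_t -> 'cV[R[i]]_2)
    (hdelta : forall j : 'I_t, 0 <= delta j < 2 * pi)
    (hpsi : forall j : 'I_t,
       [\/ psi j = ket0, psi j = ket1 | psi j = ket_plus (delta j)]) :
  ((exists (j : 'I_t) (d : R), psi j = ket_plus d) ->
     gaussian_rank (tens_ket psi) = 2%N /\
     gaussian_extent (tens_ket psi) = 2) /\
  (~ (exists (j : 'I_t) (d : R), psi j = ket_plus d) ->
     gaussian_rank (tens_ket psi) = 1%N /\
     gaussian_extent (tens_ket psi) = 1).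
Proof.
split=> [plus|noplus].
  have [|g [W [gM uW ->]]] := plus_ket_decomp _ plus.
    move=> j; have [->|->|->] := hpsi j; [exact: Or31 | exact: Or32 |].
    by apply: Or33; exists (delta j).
  apply: gaussian_rank_extent2 uW; exact: majorana_state_gaussian.
apply: gaussian_rank_extent1; apply: majorana_state_gaussian.
apply: basis_ket_majorana_state => j.
have [->|->|plus] := hpsi j; [by left | by right |].
by case: noplus; exists j, (delta j).
Qed.
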